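(* Let $\alpha$ be a quadratic Pisot unit of the form $\alpha=(b+\sqrt{b^2-4})/2$ or $\alpha=(b+\sqrt{b^2+4})/2$ with $b$ a positive integer, and let $\mathcal{L}(\alpha)=\{\limsup_{n\to\infty}\|\xi\alpha^n\| : \xi\in\mathbb{R}\}$. For $t\ge 0$ put $m=m(t)=\lfloor (2+b)t\rfloor$. Then \[ \dim_H\bigl(\mathcal{L}(\alpha)\cap[0,t]\bigr)\le \frac{\log(4m+1)}{\log\alpha}. \] In particular, $\mathcal{L}(\alpha)\cap[0,t_0]$ has Lebesgue measure zero, where $t_0=(\alpha-1)/(4(b+2))$.
   Context: $\|x\|$ denotes the distance from the real number $x$ to the nearest integer; $\lfloor x\rfloor$ is the integer part; $\dim_H$ is Hausdorff dimension. A quadratic Pisot unit is a quadratic algebraic unit $\alpha>1$ whose conjugate has absolute value less than $1$. *)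

(* Defs.v *)
From HB Require Import structures.
From mathcomp Require Import all_boot all_order all_algebra.
From mathcomp Require Import all_classical all_reals all_analysis.

Set Implicit Arguments.
Unset Strict Implicit.
Unset Printing Implicit Defensive.

Import Order.TTheory GRing.Theory Num.Theory.
Import numFieldNormedType.Exports.

Local Open Scope classical_set_scope.
Local Open Scope ring_scope.

Section Defs.
Context {R : realType}.
Implicit Types (x a : R) (A U : set R).

Definition dist_int x : R := inf [set `|x - k%:~R| | k in [set: int]].

Definition limsup_spectrum a : set R :=
  [set limn_sup (fun n => dist_int (xi * a ^+ n)) | xi in [set: R]].

Definition algebraic_unit x : Prop :=
  [/\ x != 0, integralOver (intr : int -> R) x
    & integralOver (intr : int -> R) x^-1].

(* p is the minimal polynomial of a over rat.  The conjugate a' is taken in R: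
   since a is real, so is the other root of p. *)
Definition quadratic_pisot_unit a : Prop :=
  [/\ 1 < a, algebraic_unit a
    & exists (p : {poly rat}) (a' : R),
      [/\ p \is monic, size p = 3%N, irreducible_poly p,
          map_poly ratr p = ('X - a%:P) * ('X - a'%:P) & `|a'| < 1]].

(* With this formula the empty set has diameter -oo. *)
Definition diam U : \bar R :=
  ereal_sup [set `|xy.1 - xy.2|%:E | xy in U `*` U].

(* The empty set contributes 0 for every s, whereas a singleton contributes
   0 `^ 0 = 1 when s = 0, so that the measure for s = 0 is counting measure. *)
Definition hausdorff_gauge (s : R) U : \bar R :=
  if U == set0 then 0%E else (diam U `^ s)%E.

Definition hausdorff_premeasure (s delta : R) A : \bar R :=
  ereal_inf [set (\sum_(0 <= i <oo) hausdorff_gauge s (U i))%E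
    | U in [set U : (set R)^nat |
        A `<=` \bigcup_i U i /\ forall i, (diam (U i) <= delta%:E)%E]].

Definition hausdorff_measure (s : R) A : \bar R :=
  ereal_sup [set hausdorff_premeasure s delta A
    | delta in [set delta : R | 0 < delta]].

(* The empty set has dimension 0. *)
Definition hausdorff_dim A : \bar R :=
  ereal_inf [set s%:E
    | s in [set s : R | 0 <= s /\ hausdorff_measure s A = 0%E]].

End Defs.

(* Main.v *)
Require Import Defs.
From HB Require Import structures.
From mathcomp Require Import all_boot all_order all_algebra.
From mathcomp Require Import all_classical all_reals all_analysis.
From mathcomp Require Import ring lra.
From mathcomp Require Import zify.

Set Implicit Arguments.
Unset Strict Implicit.
Unset Printing Implicit Defensive.

Import Order.TTheory GRing.Theory Num.Theory.
Import numFieldNormedType.Exports.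

Local Open Scope classical_set_scope.
Local Open Scope ring_scope.

(* Write [xi alpha^n = k_n + e_n] with [k_n] a nearest integer, and let
   [alpha^2 - b alpha + q = 0] with [q = 1] or [q = -1], so that the conjugate
   of [alpha] is [q / alpha].  The integers
     s_n = k_(n+2) - b k_(n+1) + q k_n = - (e_(n+2) - b e_(n+1) + q e_n)
   satisfy [|s_n| <= (2 + b) max |e_i|], hence [|s_n| <= m] for large [n] if the
   limsup is at most [t].  Solving the recurrence for the bounded sequence [e],
   forwards for the root [alpha] and backwards for the root [q / alpha], gives
     (alpha - q / alpha) e_(n+1)
       = s_n + sum_(1 <= j <= N) alpha^-j (s_(n+j) + q^j s_(n-j)) + O(alpha^-N).
   The digits [s_(n+j) + q^j s_(n-j)] take at most [4 m + 1] values, so the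
   spectrum below [t] is covered by [(2 m + 1) (4 m + 1)^N] intervals of length
   [O(alpha^-N)], for every [N].  At [t = t_0] one has [4 m + 1 < alpha], the
   inequality being strict because [alpha] is irrational. *)

(** * Nearest integers, and bounded sequences near their limsup *)

Section LimsupOfDistances.
Context {R : realType}.
Implicit Types x : R.

(** The infimum is attained at [k], the floor of [x + 1 / 2]: any other integer is at distance at
    least 1 from [k], hence at least 1/2 from [x]. *)
Lemma dist_int_nearest x :
  exists2 k : int, dist_int x = `|x - k%:~R| & `|x - k%:~R| <= 1 / 2.
Proof.
pose k := Num.floor (x + 1 / 2).
have /andP[k1 k2] := floor_itv (x + 1 / 2).
have kx : `|x - k%:~R| <= 1 / 2.
  by rewrite /k; move: k1 k2; rewrite intrD ler_norml => k1 k2; lra.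
exists k => //; apply/eqP; rewrite eq_le; apply/andP; split.
- apply: ge_inf; last by exists k.
  by exists 0 => _ [j _ <-].
- apply: lb_le_inf; first by exists `|x - 0%:~R|; exists 0.
  move=> _ [j _ <-]; have [->//|jk] := eqVneq j k.
  have : 1 <= `|j%:~R - k%:~R : R|.
    rewrite -intrB -intr_norm -[1]/(1%:~R) ler_int.
    by rewrite -gtz0_ge1 normr_gt0 subr_eq0.
  have := ler_normD (j%:~R - x) (x - k%:~R).
  rewrite addrA subrK (distrC j%:~R x); lra.
Qed.

(** The suprema of the tails converge to the limsup, and each is approached by a term of its own
    tail. This allows a point of the spectrum to be replaced by a single term of large index. *)
Lemma limn_sup_approx (u : R^nat) e n0 : (forall n, 0 <= u n <= 1) -> 0 < e ->
  exists2 n, (n0 <= n)%N & `|u n - limn_sup u| < e.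
Proof.
move=> u01 e0.
have bu : bounded_fun u.
  by exists 1; split => // M M1 n _ /=; have := u01 n; rewrite ler_norml; lra.
have := cvg_sups_inf (bounded_fun_has_ubound bu) (bounded_fun_has_lbound bu).
rewrite -limn_supE// => /cvgrPdist_lt /(_ (e / 2)) /(_ ltac:(lra)) [n1 _ n1P].
pose n := maxn n0 n1.
have /= sn := n1P n (leq_maxr _ _).
have hs : has_sup (sdrop u n).
  split; first by exists (u n), n => /=.
  by exists 1 => _ [k _ <-]; have /andP[] := u01 k.
have [_ [k /= nk <-] uk] := sup_adherent (eps := e / 2) ltac:(lra) hs.
exists k; first exact: leq_trans (leq_maxl _ _) nk.
have ks : u k <= sup (sdrop u n) by apply: sup_upper_bound => //; exists k.
move: sn uk ks; rewrite /sups /= !ltr_norml; lra.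
Qed.

Lemma limn_sup_lt_near (u : R^nat) l : (forall n, 0 <= u n <= 1) ->
  limn_sup u < l -> exists n0, forall n, (n0 <= n)%N -> u n < l.
Proof.
move=> u01 ul.
have bu : bounded_fun u.
  by exists 1; split => // M M1 n _ /=; have := u01 n; rewrite ler_norml; lra.
have := cvg_sups_inf (bounded_fun_has_ubound bu) (bounded_fun_has_lbound bu).
rewrite -limn_supE// => /cvgrPdist_lt /(_ (l - limn_sup u)).
move=> /(_ ltac:(lra)) [n1 _ n1P].
exists n1 => n nn1.
have /= sn := n1P n1 (leqnn _).
have ks : u n <= sups u n1.
  apply: sup_upper_bound; last by exists n.
  split; first by exists (u n), n => /=.
  by exists 1 => _ [k _ <-]; have /andP[] := u01 k.
move: sn ks; rewrite !ltr_norml; lra.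
Qed.

End LimsupOfDistances.

(** * Solving the second order recurrence with roots [a] and [c] *)

Section Recurrence.
Context {F : fieldType}.
Variables (a c : F) (e s : nat -> F).
Hypothesis rec : forall n, e n.+2 - (a + c) * e n.+1 + a * c * e n = - s n.

(** With [f n = e n.+1 - c * e n] the recurrence reads [f n.+1 = a * f n - s n], that is,
    [f n = a^-1 * (s n + f n.+1)], which is iterated [N] times. *)
Lemma rec_forward N n : a != 0 ->
  e n.+1 - c * e n = \sum_(k < N) a ^- k.+1 * s (n + k)%N
                     + a ^- N * (e (n + N).+1 - c * e (n + N)%N).
Proof.
move=> a0; elim: N => [|N IH].
  by rewrite big_ord0 addn0 expr0 invr1 mul1r add0r.
rewrite big_ord_recr /= IH -addrA; congr (_ + _).
have -> : s (n + N)%N = - (e (n + N).+2 - (a + c) * e (n + N).+1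
                           + a * c * e (n + N)%N) by rewrite rec opprK.
rewrite addnS exprS; field.
by rewrite a0 expf_neq0.
Qed.

(** With [g n = e n.+1 - a * e n] the recurrence reads [g n.+1 = c * g n - s n]; unrolling it
    expresses [g] through past values of [s]. *)
Lemma rec_backward N n :
  e (n + N).+1 - a * e (n + N)%N = c ^+ N * (e n.+1 - a * e n)
                     - \sum_(k < N) c ^+ k * s (n + N - k.+1)%N.
Proof.
elim: N => [|N IH].
  by rewrite big_ord0 addn0 expr0 mul1r subr0.
rewrite big_ord_recl /= expr0 mul1r.
under eq_bigr do rewrite /bump /= add1n addnS subSS exprS -mulrA.
rewrite -mulr_sumr addnS subn1 /= exprS -mulrA.
have -> : s (n + N)%N = - (e (n + N).+2 - (a + c) * e (n + N).+1
                           + a * c * e (n + N)%N) by rewrite rec opprK.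
move: IH => /eqP; rewrite eq_sym subr_eq => /eqP ->; ring.
Qed.

(** At index [(n + N).+1], [(a - c) * e] is the forward quantity minus the backward one. The
    backward expansion takes [N.+1] steps: its first term is the isolated [s (n + N)], and the
    others pair with the forward terms because [c ^+ k = a ^- k * q ^+ k]. *)
Lemma rec_green N n (q : F) : a != 0 -> c = q / a ->
  (a - c) * e (n + N).+1 =
    s (n + N)%N
    + \sum_(k < N) a ^- k.+1 * (s (n + N + k.+1)%N + q ^+ k.+1 * s (n + N - k.+1)%N)
    + (a ^- N * (e (n + N + N).+2 - c * e (n + N + N).+1)
       - c ^+ N.+1 * (e n.+1 - a * e n)).
Proof.
move=> a0 cE; have := rec_forward N (n + N).+1 a0; have := rec_backward N.+1 n.
rewrite big_ord_recl /= expr0 mul1r addnS subn1 /= !addSn => gE fE.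
have -> : (a - c) * e (n + N).+1 = (e (n + N).+2 - c * e (n + N).+1)
           - (e (n + N).+2 - a * e (n + N).+1) by ring.
rewrite gE fE.
under [X in _ + X + _]eq_bigr do rewrite mulrDr.
rewrite big_split /=.
have -> : \sum_(k < N) a ^- k.+1 * s ((n + N).+1 + k)%N =
          \sum_(k < N) a ^- k.+1 * s (n + N + k.+1)%N.
  by apply: eq_bigr => k _; rewrite addSnnS.
have -> : \sum_(k < N) c ^+ bump 0 k * s ((n + N).+1 - (bump 0 k).+1)%N =
          \sum_(k < N) a ^- k.+1 * (q ^+ k.+1 * s (n + N - k.+1)%N).
  apply: eq_bigr => k _; rewrite /bump /= add1n subSS.
  by rewrite cE expr_div_n mulrA [_ / _]mulrC.
ring.
Qed.

End Recurrence.

(** * Finite digit expansions in base [a], and their number *)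

Section Grid.
Context {R : realType}.

Definition digits (K : nat) : seq R := [seq i%:R - K%:R | i <- iota 0 (2 * K).+1].
Arguments digits : simpl never.

Lemma mem_digits K (z : int) : `|z| <= K%:Z -> z%:~R \in digits K.
Proof.
move=> zK; apply/mapP; exists (absz (z + K%:Z)); first by rewrite mem_iota; lia.
by rewrite [in RHS]pmulrn gez0_abs ?intrD ?addrK//; lia.
Qed.

(** Coinciding values are listed repeatedly, so the length is exactly the number of digit
    strings. *)
Fixpoint grid (a : R) (m N : nat) : seq R :=
  if N is N'.+1 then
    [seq p + a ^- N * d | p <- grid a m N', d <- digits (2 * m)]
  else digits m.

Lemma size_grid a m N : size (grid a m N) = ((2 * m).+1 * (4 * m).+1 ^ N)%N.
Proof.
elim: N => [|N IH]; first by rewrite /= size_map size_iota muln1.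
rewrite [size _](size_allpairs (fun p d => p + a ^- N.+1 * d)).
by rewrite IH size_map size_iota expnSr !mulnA.
Qed.

Lemma mem_grid a m N (z : int) (d : nat -> int) :
  `|z| <= m%:Z -> (forall k, (k < N)%N -> `|d k| <= (2 * m)%N%:Z) ->
  z%:~R + \sum_(k < N) a ^- k.+1 * (d k)%:~R \in grid a m N.
Proof.
move=> zm; elim: N => [|N IH] dm; first by rewrite big_ord0 addr0 mem_digits.
rewrite big_ord_recr addrA.
apply: (allpairs_f (fun p d => p + a ^- N.+1 * d)); last exact/mem_digits/dm.
by apply: IH => k kN; apply: dm; rewrite ltnS ltnW.
Qed.

End Grid.

(** * Approximation of spectrum points by grid points *)

Section Spectrum.
Context {R : realType}.
Implicit Types (a t x : R) (b m N : nat) (q : int).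

Lemma conj_norm a q : 0 < a -> `|q| = 1 -> `|q%:~R / a| = a^-1.
Proof.
by move=> a0 q1; rewrite normrM -intr_norm q1 mul1r gtr0_norm ?invr_gt0.
Qed.

Lemma conj_sum a b q : a != 0 -> a ^+ 2 - b%:R * a + q%:~R = 0 ->
  a + q%:~R / a = b%:R.
Proof.
move=> a0 aE; have -> : q%:~R = b%:R * a - a ^+ 2 :> R by lra.
by field.
Qed.

Lemma conj_lt1 a q : 1 < a -> `|q| = 1 -> `|q%:~R / a| < 1.
Proof. by move=> a1 q1; rewrite conj_norm ?invf_lt1//; lra. Qed.

Lemma conj_gap_gt0 a q : 1 < a -> `|q| = 1 -> 0 < a - q%:~R / a.
Proof. by move=> a1 /(conj_lt1 a1); rewrite ltr_norml; lra. Qed.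

(** Only the absolute value of [e n] is seen by the spectrum, hence [|p|]. In the error,
    [2 / (a - q / a)] comes from truncating the expansion, and 1 from replacing the limsup by one
    term. *)
Lemma spectrum_grid a b q m t x N :
  1 < a -> `|q| = 1 -> a ^+ 2 - b%:R * a + q%:~R = 0 ->
  (2 + b%:R) * t < m%:R + 1 -> limsup_spectrum a x -> x <= t ->
  exists2 p, p \in grid a m N &
    `|x - `|p| / (a - q%:~R / a)| <= (2 / (a - q%:~R / a) + 1) * a ^- N.
Proof.
move=> a1 q1 aE mt [xi _ <-] {x}; set u := fun n => _ => ut.
have a_gt0 : 0 < a by lra.
have a0 : a != 0 by rewrite gt_eqF.
set c := q%:~R / a; have cE : c = q%:~R / a by [].
have D0 : 0 < a - c by exact: conj_gap_gt0.
have c_norm : `|c| = a^-1 by exact: conj_norm.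
have c_lt1 : `|c| < 1 by exact: conj_lt1.
have c_sum : a + c = b%:R by exact: conj_sum.
have acE : a * c = q%:~R by rewrite cE; field.
clearbody c.
have q1R : `|q%:~R : R| = 1 by rewrite -intr_norm q1.
have [k kP ke] : exists2 k : nat -> int,
    forall n, u n = `|xi * a ^+ n - (k n)%:~R|
  & forall n, `|xi * a ^+ n - (k n)%:~R| <= 1 / 2.
  have /choice[k kP] : forall n, exists k : int,
      u n = `|xi * a ^+ n - k%:~R| /\ `|xi * a ^+ n - k%:~R| <= 1 / 2.
    by move=> n; have [k] := dist_int_nearest (xi * a ^+ n); exists k.
  by exists k => n; have [] := kP n.
pose e n := xi * a ^+ n - (k n)%:~R.
have {}kP n : u n = `|e n| by exact: kP.
have {}ke n : `|e n| <= 1 / 2 by exact: ke.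
pose s n : int := k n.+2 - b%:Z * k n.+1 + q * k n.
(* Since [a] is a root, the terms [xi * a ^+ n] satisfy the homogeneous recurrence and cancel. *)
have rec n : e n.+2 - (a + c) * e n.+1 + a * c * e n = - (s n)%:~R.
  have qE : q%:~R = b%:R * a - a ^+ 2 :> R by move: aE; lra.
  rewrite c_sum acE /s intrD intrB !intrM -pmulrn.
  rewrite /e !exprS qE; ring.
have u01 n : 0 <= u n <= 1.
  by rewrite kP normr_ge0 /=; have := ke n; lra.
have b0 : 0 <= b%:R :> R by [].
(* The threshold strictly exceeds [t], so it bounds all late terms even if the limsup equals [t]. *)
have [n0 un0] : exists n0, forall n, (n0 <= n)%N -> u n < (m%:R + 1) / (2 + b%:R).
  apply: limn_sup_lt_near => //; apply: le_lt_trans ut _.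
  by rewrite ltr_pdivlMr 1?mulrC//; lra.
(* The coefficients 1, [b], [q] have absolute values summing to [2 + b], so [|s n| < m + 1];
   integrality then gives [|s n| <= m]. *)
have sm n : (n0 <= n)%N -> `|s n| <= m%:Z.
  move=> nn0; rewrite -ltzD1 -(ltr_int R) intr_norm intrD -pmulrn.
  rewrite -normrN -rec c_sum acE.
  have h0 := un0 n nn0; have h1 := un0 n.+1 (leqW nn0).
  have h2 := un0 n.+2 (leqW (leqW nn0)).
  have := mulr_ge0 b0 b0.
  have tri := ler_normD (e n.+2 - b%:R * e n.+1) (q%:~R * e n).
  have tri' := ler_normB (e n.+2) (b%:R * e n.+1).
  have : `|b%:R * e n.+1| <= b%:R * ((m%:R + 1) / (2 + b%:R)).
    rewrite normrM ger0_norm// ler_wpM2l//; rewrite kP in h1; exact: ltW.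
  move: tri; rewrite normrM q1R mul1r => tri; rewrite !kP in h0 h2.
  have : (2 + b%:R) * ((m%:R + 1) / (2 + b%:R)) = m%:R + 1 :> R.
    by rewrite mulrC divfK// gt_eqF//; lra.
  set v := (_ + _) / _ in h0 h1 h2 *.
  by move: h0 h2 tri tri'; lra.
have aN0 : 0 < a ^- N by rewrite invr_gt0 exprn_gt0//; lra.
(* The index is taken so large that the [N] digits looking back from it still have indices at least
   [n0]. *)
have [n nn0 nx] := limn_sup_approx (n0 + N + N).+1 u01 aN0.
have [n' n'0 nE] : exists2 n', (n0 <= n')%N & n = (n' + N).+1.
  by exists (n - N.+1)%N; clear -nn0; lia.
pose d j : int := s (n' + N + j.+1)%N + q ^+ j.+1 * s (n' + N - j.+1)%N.
exists ((s (n' + N)%N)%:~R + \sum_(j < N) a ^- j.+1 * (d j)%:~R).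
  apply: mem_grid => [|j jN]; first by apply: sm; clear -n'0; lia.
  apply: le_trans (ler_normD _ _) _.
  rewrite normrM normrX q1 expr1n mul1r mul2n -addnn PoszD.
  by apply: lerD; apply: sm; clear -n'0 jN; lia.
have := rec_green rec N n' a0 cE.
under [X in _ + X + _]eq_bigr do rewrite -rmorphXn /= -rmorphM -rmorphD /=.
rewrite -/(d _); set p := (X in _ = X + _); set r := (X in _ = p + X) => gE.
(* Each boundary term contributes at most [a ^- N]: the forward factor is at most
   [(1 + |c|) / 2 <= 1], and the backward one at most [(1 + a) / 2 <= a], which absorbs the extra
   power in [c ^+ N.+1]. *)
have rN : `|r| <= 2 * a ^- N.
  have : `|e (n' + N + N).+2 - c * e (n' + N + N).+1| <= 1.
    have := ler_normB (e (n' + N + N).+2) (c * e (n' + N + N).+1).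
    have := ke (n' + N + N).+2; have := ke (n' + N + N).+1.
    rewrite normrM; have := normr_ge0 c; nra.
  have : `|e n'.+1 - a * e n'| <= a.
    have := ler_normB (e n'.+1) (a * e n').
    have := ke n'.+1; have := ke n'; rewrite normrM.
    rewrite (gtr0_norm a_gt0); nra.
  move=> h1 h2; rewrite /r; apply: le_trans (ler_normB _ _) _.
  rewrite !normrM normrX c_norm (gtr0_norm aN0).
  have -> : 2 * a ^- N = a ^- N * 1 + (a^-1) ^+ N.+1 * a.
    by rewrite exprVn exprS; field; rewrite a0 expf_neq0.
  by rewrite lerD// ler_wpM2l ?(ltW aN0)// exprn_ge0// invr_ge0; lra.
have uE : u n = `|p + r| / (a - c).
  by rewrite kP nE -gE normrM (gtr0_norm D0) mulrAC divff ?mul1r ?gt_eqF.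
have h : `|u n - `|p| / (a - c)| <= 2 / (a - c) * a ^- N.
  rewrite uE -mulrBl normrM (@gtr0_norm _ (a - c)^-1) ?invr_gt0//.
  rewrite [leRHS]mulrAC ler_pM2r ?invr_gt0//; apply: le_trans rN.
  by have := ler_dist_dist (p + r) p; rewrite [p + r]addrC addrK.
apply: le_trans (ler_distD (u n) _ _) _.
by rewrite [X in X + _]distrC [leRHS]mulrDl mul1r [leRHS]addrC lerD// ltW.
Qed.

End Spectrum.

(** * Hausdorff and Lebesgue bounds from finite covers by balls *)

Section Covers.
Context {R : realType}.
Implicit Types (A : set R) (c : seq R) (r s delta : R).

Definition covered A c r := forall x, A x -> exists2 p, p \in c & `|x - p| <= r.

Lemma hausdorff_gauge_ge0 s (U : set R) : (0 <= hausdorff_gauge s U)%E.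
Proof. by rewrite /hausdorff_gauge; case: ifP => // _; exact: poweR_ge0. Qed.

Lemma hausdorff_premeasure_ge0 s delta A : (0 <= hausdorff_premeasure s delta A)%E.
Proof.
apply: le_ereal_inf_tmp => _ [U _ <-].
by apply: nneseries_ge0 => i _ _; exact: hausdorff_gauge_ge0.
Qed.

Lemma diam_closed_ball p r : (diam [set y | (`|y - p| <= r)%R] <= (2 * r)%:E)%E.
Proof.
apply: ge_ereal_sup => _ [[x y] [/= xp yp] <-]; rewrite lee_fin.
by have := ler_distD p x y; rewrite (distrC p); lra.
Qed.

Lemma diam_set0 : diam (set0 : set R) = -oo%E.
Proof. by apply/ereal_sup_ninfty => _ [[x y] [/= []]]. Qed.

Lemma diam_ge0 (U : set R) : U !=set0 -> (0 <= diam U)%E.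
Proof.
move=> [x Ux]; apply: ereal_sup_ubound.
by exists (x, x) => //=; rewrite subrr normr0.
Qed.

Lemma hausdorff_premeasure_cover s delta A c r :
  0 <= s -> 0 <= r -> 2 * r <= delta -> covered A c r ->
  (hausdorff_premeasure s delta A <= ((size c)%:R * (2 * r) `^ s)%:E)%E.
Proof.
move=> s0 r0 rd Ac.
(* The finite cover is padded to a sequence by empty sets, whose gauge is 0 for every [s], including
   [s = 0]. *)
pose U i : set R := if (i < size c)%N then [set y | `|y - c`_i| <= r] else set0.
have dU i : (diam (U i) <= (2 * r)%:E)%E.
  rewrite /U; case: ifP => _; first exact: diam_closed_ball.
  by rewrite diam_set0 leNye.
apply: ge_ereal_inf; exists (\sum_(0 <= i <oo) hausdorff_gauge s (U i))%E.
  exists U => //; split => [x /Ac[p pc xp]|i].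
    exists (index p c) => //=.
    by rewrite /U index_mem pc nth_index.
  by apply: le_trans (dU i) _; rewrite lee_fin.
rewrite (@nneseries_split _ _ 0 (size c)); last first.
  by move=> i _; exact: hausdorff_gauge_ge0.
rewrite add0n eseries0 ?adde0; last first.
  move=> i ci _; rewrite /U ltnNge ci /= /hausdorff_gauge.
  by rewrite eqxx.
have -> : ((size c)%:R * (2 * r) `^ s)%:E =
          (\sum_(0 <= i < size c) ((2 * r) `^ s)%:E)%E.
  by rewrite sumEFin sumr_const_nat subn0 mulr_natl.
apply: lee_sum => i _; rewrite /hausdorff_gauge; case: ifPn => [_|/set0P Ui].
  by rewrite lee_fin powR_ge0.
rewrite -poweR_EFin; apply: gt0_ler_poweR => //.
- by rewrite in_itv /= diam_ge0// leey.
- by rewrite in_itv /= lee_fin leey mulr_ge0.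
Qed.

(** Since [A] is not assumed measurable, the bound is placed on a finite union of closed intervals
    containing it. *)
Lemma lebesgue_cover A c r : 0 <= r -> covered A c r ->
  exists2 B, measurable B /\ A `<=` B &
    (@lebesgue_measure R B <= ((size c)%:R * (2 * r))%:E)%E.
Proof.
move=> r0 Ac; pose U i : set R := `[c`_i - r, c`_i + r]%classic.
have mU i : measurable (U i) by exact: measurable_itv.
exists (\big[setU/set0]_(i < size c) U i).
  split; first exact: bigsetU_measurable.
  move=> x /Ac[p pc xp]; rewrite -bigcup_mkord; exists (index p c) => /=.
    by rewrite index_mem.
  by rewrite /U /= in_itv /= nth_index//; move: xp; rewrite ler_norml; lra.
have /le_trans := @le_mu_bigsetU _ _ _ (@lebesgue_measure R) U (size c)
  (fun i _ => mU i).
apply.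
have -> : ((size c)%:R * (2 * r))%:E = (\sum_(i < size c) (2 * r)%:E)%E.
  by rewrite sumEFin sumr_const card_ord mulr_natl.
apply: lee_sum => i _; rewrite [leLHS](@lebesgue_measure_itv _ `[_, _]) /=.
case: ifP => _; rewrite -?EFinB lee_fin ?mulr_ge0//; lra.
Qed.

Lemma geometric_small (k z e : R) : 0 <= z < 1 -> 0 < e ->
  \forall N \near \oo, k * z ^+ N < e.
Proof.
move=> z01 e0; have /cvgrPdist_lt /(_ _ e0) : geometric k z @ \oo --> 0.
  by apply: cvg_geometric; rewrite ger0_norm; lra.
apply: filterS => N; rewrite sub0r normrN; exact/le_lt_trans/ler_norm.
Qed.

(** The [N]-th cover has gauge sum at most [K * (2 * C)]^ s * (M / a [^ s) ^+ N], which tends to 0,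
    while its diameters drop below any [delta]. *)
Lemma hausdorff_measure_eq0 A (a C s : R) (K M : nat) (c : nat -> seq R) :
  1 < a -> 0 < C -> 0 <= s -> M%:R < a `^ s ->
  (forall N, size (c N) = (K * M ^ N)%N) ->
  (forall N, covered A (c N) (C * a ^- N)) ->
  hausdorff_measure s A = 0%E.
Proof.
move=> a1 C0 s0 Ms cK Ac.
have as0 : 0 < a `^ s by rewrite powR_gt0; lra.
suff pre0 delta : 0 < delta -> hausdorff_premeasure s delta A = 0%E.
  rewrite /hausdorff_measure.
  rewrite -[RHS]ereal_sup1; congr ereal_sup; apply/seteqP; split.
    by move=> _ [delta d0 <-]; exact: pre0.
  (* One admissible scale is exhibited because the supremum over no scales would be [-oo]. *)
  by move=> _ ->; exists 1 => /=; [exact: ltr01|exact: pre0].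
move=> d0; apply/eqP; rewrite eq_le hausdorff_premeasure_ge0 andbT.
apply/lee_addgt0Pr => e e0; rewrite add0e.
have small1 : \forall N \near \oo, 2 * C * a^-1 ^+ N < delta.
  by apply: geometric_small => //; rewrite invr_ge0 invf_lt1; lra.
have small2 : \forall N \near \oo, K%:R * (2 * C) `^ s * (M%:R / a `^ s) ^+ N < e.
  apply: geometric_small => //.
  by rewrite divr_ge0 ?(ltW as0)//= ltr_pdivrMr// mul1r.
have [N [N1 N2]] : exists N, 2 * C * a^-1 ^+ N < delta /\
    K%:R * (2 * C) `^ s * (M%:R / a `^ s) ^+ N < e.
  have [N ?] := filter_ex (filterI small1 small2).
  by exists N.
have aN0 : 0 <= a ^- N by rewrite invr_ge0 exprn_ge0//; lra.
apply: le_trans (hausdorff_premeasure_cover s0 _ _ (Ac N)) _.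
- by rewrite mulr_ge0// ltW.
- by rewrite mulrA -exprVn ltW.
rewrite lee_fin; apply: le_trans (ltW N2).
rewrite cK natrM natrX [2 * _]mulrA powRM ?mulr_ge0 ?(ltW C0)//.
have -> : (a ^- N) `^ s = (a `^ s) ^- N.
  rewrite -(powR_invn N (ltW (lt_trans ltr01 a1))) -powRrM.
  by rewrite mulNr mulrC powRN powRrM powR_mulrn// ltW.
by rewrite expr_div_n le_eqVlt; apply/orP; left; apply/eqP; ring.
Qed.

(** For [s = ln M / ln a + e] with [e > 0], [a]^ s[is]M[times]a [^ e], hence larger than [M], and
    the measure vanishes; [e] is arbitrary. *)
Lemma hausdorff_dim_le A (a C : R) (K M : nat) (c : nat -> seq R) :
  1 < a -> 0 < C -> (0 < M)%N ->
  (forall N, size (c N) = (K * M ^ N)%N) ->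
  (forall N, covered A (c N) (C * a ^- N)) ->
  (hausdorff_dim A <= (ln M%:R / ln a)%:E)%E.
Proof.
move=> a1 C0 M0 cK Ac; apply/lee_addgt0Pr => e e0.
have lna : 0 < ln a by exact: ln_gt0.
have M1 : 0 <= ln M%:R :> R by rewrite ln_ge0// ler1n.
have s0 : 0 <= ln M%:R / ln a + e by rewrite addr_ge0 ?divr_ge0// ltW.
apply: ereal_inf_lbound; exists (ln M%:R / ln a + e); last by [].
split=> //; apply: (hausdorff_measure_eq0 a1 C0 s0 _ cK Ac).
rewrite /powR gt_eqF; last lra.
rewrite -[ltLHS]lnK ?posrE ?ltr0n// ltr_expR mulrDl divfK ?gt_eqF//.
by rewrite ltrDl mulr_gt0.
Qed.

(** The measurable null set is the intersection of the supersets from all the covers, the [N]-th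
    having measure at most [K * (2 * C) * (M / a) ^+ N]. *)
Lemma negligible_cover A (a C : R) (K M : nat) (c : nat -> seq R) :
  1 < a -> 0 < C -> M%:R < a ->
  (forall N, size (c N) = (K * M ^ N)%N) ->
  (forall N, covered A (c N) (C * a ^- N)) ->
  (@lebesgue_measure R).-negligible A.
Proof.
move=> a1 C0 Ma cK Ac.
have aN0 N : 0 <= C * a ^- N.
  by rewrite mulr_ge0 ?(ltW C0)// invr_ge0 exprn_ge0//; lra.
have /choice[B BP] : forall N, exists B, [/\ measurable B, A `<=` B &
    (@lebesgue_measure R B <= ((size (c N))%:R * (2 * (C * a ^- N)))%:E)%E].
  move=> N; have [B [? ?] ?] := lebesgue_cover (aN0 N) (Ac N).
  by exists B.
have mB N : measurable (B N) by have [] := BP N.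
exists (\bigcap_N B N); split.
- by apply: bigcap_measurableType => N _; exact: mB.
- apply/eqP; rewrite eq_le [(0 <= _)%E](@measure_ge0 _ _ _ (@lebesgue_measure R)) andbT.
  apply/lee_addgt0Pr => e e0; rewrite add0e.
  have [N] : exists N, K%:R * (2 * C) * (M%:R / a) ^+ N < e.
    apply: (@filter_ex _ \oo); apply: geometric_small => //.
    by rewrite divr_ge0 ?ltr_pdivrMr ?mul1r//=; lra.
  have [_ _ BN] := BP N.
  move=> Ne; apply: (@le_trans _ _ (lebesgue_measure (B N))).
    apply: (@le_measure _ _ _ (@lebesgue_measure R)); rewrite ?inE//.
    - by apply: bigcap_measurableType => N' _; exact: mB.
    - exact: mB.
    - exact: bigcap_inf.
  apply: le_trans BN _; rewrite lee_fin; apply: le_trans (ltW Ne).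
  by rewrite cK natrM natrX expr_div_n le_eqVlt; apply/orP; left; apply/eqP; ring.
- by move=> x Ax N _; have [_ + _] := BP N; apply.
Qed.

End Covers.

(** * The covers applied to the spectrum below [t] *)

Section SpectrumCover.
Context {R : realType}.
Variables (a : R) (b m : nat) (q : int) (t : R).
Hypotheses (a1 : 1 < a) (q1 : `|q| = 1) (aE : a ^+ 2 - b%:R * a + q%:~R = 0).
Hypothesis mt : (2 + b%:R) * t < m%:R + 1.

Let D := a - q%:~R / a.

Let centers N := [seq `|p| / D | p <- grid a m N].

Lemma spectrum_covered N :
  covered (limsup_spectrum a `&` `[0, t]%classic) (centers N) ((2 / D + 1) * a ^- N).
Proof.
move=> x [ax]; rewrite /= in_itv /= => /andP[_ xt].
have [p pg px] := spectrum_grid N a1 q1 aE mt ax xt.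
by exists (`|p| / D) => //; apply: map_f.
Qed.

Lemma size_centers N : size (centers N) = ((2 * m).+1 * (4 * m).+1 ^ N)%N.
Proof. by rewrite size_map size_grid. Qed.

Lemma radius_gt0 : 0 < 2 / D + 1.
Proof. by rewrite addr_gt0 // divr_gt0 // conj_gap_gt0. Qed.

Lemma spectrum_dim :
  (hausdorff_dim (limsup_spectrum a `&` `[0%R, t]%classic)
     <= (ln (4 * m%:R + 1) / ln a)%:E)%E.
Proof.
have := hausdorff_dim_le a1 radius_gt0 (ltn0Sn _) size_centers spectrum_covered.
by rewrite -natrM natr1.
Qed.

Lemma spectrum_negligible : 4 * m%:R + 1 < a ->
  (@lebesgue_measure R).-negligible (limsup_spectrum a `&` `[0, t]%classic).
Proof.
rewrite -natrM natr1 => ma.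
exact: negligible_cover a1 radius_gt0 ma size_centers spectrum_covered.
Qed.

End SpectrumCover.

(** * The quadratic equation of [alpha], its irrationality at integers, and the conclusion *)

Lemma quadratic_unit_equation (R : realType) (b : nat) (a : R) : 1 < a ->
  a = (b%:R + Num.sqrt (b%:R ^+ 2 - 4)) / 2 \/
  a = (b%:R + Num.sqrt (b%:R ^+ 2 + 4)) / 2 ->
  exists2 q : int, `|q| = 1 & a ^+ 2 - b%:R * a + q%:~R = 0.
Proof.
move=> a1 [aE|aE].
- exists 1 => //.
  have [d0|d0] := leP 0 (b%:R ^+ 2 - 4 : R).
    have := sqr_sqrtr d0; move: aE; set r := Num.sqrt _ => -> rE.
    rewrite (_ : _ + _ = (r ^+ 2 - (b%:R ^+ 2 - 4)) / 4); last by field.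
    by rewrite rE subrr mul0r.
  (* The square root of a negative number is 0 by convention, so here [a = b / 2] with [b ^+ 2 < 4],
     contradicting [1 < a]. *)
  move: aE; rewrite ltr0_sqrtr// addr0 => aE.
  have b1 : 0 <= b%:R :> R by [].
  nra.
- exists (-1) => //.
  have d0 : 0 <= b%:R ^+ 2 + 4 :> R by rewrite addr_ge0// sqr_ge0.
  have := sqr_sqrtr d0; move: aE; set r := Num.sqrt _ => -> rE.
  rewrite (_ : _ + _ = (r ^+ 2 - (b%:R ^+ 2 + 4)) / 4); last by field.
    by rewrite rE subrr mul0r.
Qed.

(* If [a] were an integer, so would be its conjugate [b - a = q / a], which is
   nonzero and of absolute value less than 1. *)
Lemma quadratic_unit_not_int (R : realType) (b : nat) (q k : int) (a : R) :
  1 < a -> `|q| = 1 -> a ^+ 2 - b%:R * a + q%:~R = 0 -> a != k%:~R.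
Proof.
move=> a1 q1 aE; apply/eqP => ak.
have a0 : a != 0 by rewrite gt_eqF; lra.
have bk : (b%:Z - k)%:~R = q%:~R / a :> R.
  by rewrite intrB -ak -pmulrn -(conj_sum a0 aE) addrAC subrr add0r.
have := conj_lt1 a1 q1; rewrite -bk -intr_norm -[1]/(1%:~R) ltr_int => lt1.
have b0 : b%:Z - k = 0 by lia.
move: bk; rewrite b0 => /esym/eqP; rewrite mulf_eq0 invr_eq0 (negPf a0) orbF.
by rewrite intr_eq0 => /eqP q0; rewrite q0 in q1.
Qed.

Theorem theorem2p3 (R : realType) (b : nat) (alpha : R)
  (hb : (0 < b)%N)
  (hpisot : quadratic_pisot_unit alpha)
  (halpha : alpha = (b%:R + Num.sqrt (b%:R ^+ 2 - 4)) / 2 \/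
            alpha = (b%:R + Num.sqrt (b%:R ^+ 2 + 4)) / 2) :
  (forall t : R, 0 <= t ->
     let m : int := Num.floor ((2 + b%:R) * t) in
     (hausdorff_dim (limsup_spectrum alpha `&` `[0%R, t]%classic)
        <= (ln (4 * m%:~R + 1) / ln alpha)%:E)%E) /\
  (let t0 : R := (alpha - 1) / (4 * (b%:R + 2)) in
   (@lebesgue_measure R).-negligible (limsup_spectrum alpha `&` `[0, t0]%classic)).
Proof.
have a1 : 1 < alpha by have [] := hpisot.
have [q q1 aE] := quadratic_unit_equation a1 halpha.
have floorE (t : R) : 0 <= t -> exists2 n : nat, Num.floor ((2 + b%:R) * t) = n%:Z &
    n%:R <= (2 + b%:R) * t < n%:R + 1.
  move=> t0; have := floor_itv ((2 + b%:R) * t).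
  have : 0 <= Num.floor ((2 + b%:R) * t).
    by rewrite floor_ge0 mulr_ge0// addr_ge0.
  by case: (Num.floor _) => // n _; rewrite intrD -pmulrn; exists n.
split=> [t t0|].
  have [n -> /andP[_ nt]] := floorE t t0.
  exact: spectrum_dim a1 q1 aE nt.
set t0 := _ / _.
have b0 : 0 <= b%:R :> R by [].
have t0_ge0 : 0 <= t0 by rewrite divr_ge0//; lra.
have [n _ /andP[nt nt1]] := floorE t0 t0_ge0.
apply: (spectrum_negligible a1 q1 aE nt1).
have t0E : (2 + b%:R) * t0 = (alpha - 1) / 4.
  by rewrite /t0; field; rewrite gt_eqF//; lra.
(* From [n <= (2 + b) * t0 = (alpha - 1) / 4] one gets only [4 * n + 1 <= alpha]; equality would
   make [alpha] an integer. *)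
rewrite lt_neqAle; apply/andP; split.
- rewrite eq_sym.
  rewrite (_ : 4 * _ + 1 = (4 * n%:Z + 1)%:~R) ?(quadratic_unit_not_int _ a1 q1 aE)//.
  by rewrite intrD intrM.
- by move: nt; rewrite t0E; lra.
Qed.
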